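(* Let $r\ge 3$ be an integer. (1) Let $H$ be a $2$-extreme marked $r$-uniform clique on at least $2r-2$ vertices. If every subset of $2r-2$ vertices of $V(H)$ has an agreeing linear order, then $H$ has an agreeing linear order. (2) Furthermore, there exists a $2$-extreme marked $r$-uniform clique $H$ on at least $2r-2$ vertices such that every set of $2r-3$ vertices of $H$ has an agreeing linear order, but $H$ does not have an agreeing linear order.
   Context: All hypergraphs are finite. An $r$-uniform clique is a complete $r$-uniform hypergraph $H$ with no repeated edges, i.e. its edge set $E(H)$ consists of all $r$-element subsets of its vertex set $V(H)$. A $2$-extreme marked $r$-uniform clique is an $r$-uniform clique $H$ together with, for every edge $e\in E(H)$, a set $\partial e\subseteq e$ of exactly two marked vertices. For $U\subseteq V(H)$, a linear order $L$ on $U$ is an agreeing linear order of $U$ if for every edge $e\in E(H)$ with $e\subseteq U$, the set consisting of the $L$-minimal and the $L$-maximal elements of $e$ equals $\partial e$. An agreeing linear order of $H$ is an agreeing linear order of $V(H)$. *)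

(* Defs.v *)
From mathcomp Require Import all_boot.

Set Implicit Arguments.
Unset Strict Implicit.
Unset Printing Implicit Defensive.

Definition clique_edges (r : nat) (V : finType) : {set {set V}} :=
  [set e : {set V} | #|e| == r].

(* The value of [marks] outside the edge set is irrelevant. *)
Record marked_clique (r : nat) := MarkedClique {
  vertex : finType;
  marks : {set vertex} -> {set vertex};
  marks_sub : forall e, e \in clique_edges r vertex -> marks e \subset e;
  marks_card : forall e, e \in clique_edges r vertex -> #|marks e| = 2 }.

Definition edges (r : nat) (H : marked_clique r) : {set {set vertex H}} :=
  clique_edges r (vertex H).

(* A non-strict linear order on U is encoded by a relation on the ambient type
   whose values outside U are unconstrained. *)
Definition linear_order_on (V : finType) (U : {set V}) (L : rel V) : Prop :=
  [/\ {in U, reflexive L}, {in U &, antisymmetric L},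
      {in U & &, transitive L} & {in U &, total L}].

Definition minimals (V : finType) (L : rel V) (e : {set V}) : {set V} :=
  [set x in e | [forall y in e, L y x ==> (y == x)]].

Definition maximals (V : finType) (L : rel V) (e : {set V}) : {set V} :=
  [set x in e | [forall y in e, L x y ==> (y == x)]].

Definition agreeing_linear_order (r : nat) (H : marked_clique r)
    (U : {set vertex H}) (L : rel (vertex H)) : Prop :=
  linear_order_on U L /\
  forall e, e \in edges H -> e \subset U ->
    minimals L e :|: maximals L e = marks e.

Definition has_agreeing_order_on (r : nat) (H : marked_clique r)
    (U : {set vertex H}) : Prop :=
  exists L : rel (vertex H), agreeing_linear_order U L.

Definition has_agreeing_order (r : nat) (H : marked_clique r) : Prop :=
  has_agreeing_order_on [set: vertex H].

(* Main.v *)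
Require Import Defs.
From mathcomp Require Import all_boot zify.

Set Implicit Arguments.
Unset Strict Implicit.
Unset Printing Implicit Defensive.

(** Part (1). The marks of an edge are its two ends, and whether a vertex is an
    end depends only on the betweenness relation of the order; so the task is
    to find one betweenness relation inducing all the marks.

    The marks inside a set [A] of at least [r] vertices determine the two ends
    of [A]: they are the vertices marked in every edge of [A] that contains
    them ([mem_ends_marks]). Hence if two orders agree on [U], every initial
    or final segment of [U] for the first order that has at least [r] elements
    has the same two ends for the second. When [#|U| = 2 * r - 3] each triple
    is controlled by such segments, because the closed initial and the closed
    final segment at a vertex have [2 * r - 2] elements altogether; so the two
    orders have the same betweenness ([btw_agrees]).

    Two sets of size [2 * r - 2] can be joined by exchanging one vertex at a
    time, and consecutive sets share [2 * r - 3] vertices. The local orders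
    therefore define one betweenness relation on all of [V] ([btw_common]).
    As [4 <= 2 * r - 2], it is the betweenness of a linear order on every four
    points, and such a relation is globally that of a linear order
    ([betweenness_representable]). That order has the right ends on every edge.

    Part (2). Order [2 * r - 2] vertices naturally and mark each edge by its
    ends, except for the edge [top] of the last [r] vertices, which is marked
    as if its first two vertices [p] and [q] were swapped. The edge [bot] of the
    first [r] vertices ends in [p], [q]. The edges [top] and [bot] are the only
    ones whose ends change under the swap, and together they cover all the
    vertices. So a set that misses a vertex does not contain both, and it is
    ordered naturally or with [p] and [q] swapped. Globally [bot] forces
    [p < q] while [top] forces [q < p].

    Orders are handled as injective rank functions into [nat], which turns
    every configuration of a few points into linear arithmetic. *)

(** * Linear orders as rank functions *)

Section Ranks.
Variable V : finType.
Implicit Types (f g : V -> nat) (x y z : V) (A B C D U : {set V}).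

Definition btw f x y z := (f x < f y < f z) || (f z < f y < f x).

Definition ends f A :=
  [set x in A | [forall y in A, forall z in A, ~~ btw f y x z]].

Lemma endsP f A x :
  reflect (x \in A /\ {in A &, forall y z, ~~ btw f y x z}) (x \in ends f A).
Proof.
rewrite inE; apply: (iffP andP) => -[xA xE]; split=> //.
  by move=> y z yA zA; move/forall_inP/(_ y yA)/forall_inP/(_ z zA): xE.
by apply/forall_inP => y yA; apply/forall_inP => z zA; apply: xE.
Qed.

Lemma eq_ends f g A :
  {in A & &, forall x y z, btw f x y z = btw g x y z} -> ends f A = ends g A.
Proof.
move=> fg; apply/setP => x; apply/endsP/endsP => -[xA xE]; split=> // y z yA zA.
  by rewrite -fg // xE.
by rewrite fg // xE.
Qed.

Lemma rank_linear f U :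
  {in U &, injective f} -> linear_order_on U (fun x y => f x <= f y).
Proof.
move=> f_inj; split.
- by move=> x _ /=.
- by move=> x y xU yU le_xy; apply: f_inj => //; lia.
- by move=> x y z _ _ _ /=; lia.
- by move=> x y _ _; lia.
Qed.

(** Initial segments of a linear order are nested, so their sizes rank the
    elements. *)
Lemma linear_rank U (L : rel V) :
  linear_order_on U L ->
  exists f, {in U &, injective f} /\ {in U &, forall x y, L x y = (f x <= f y)}.
Proof.
case=> Lrefl Lanti Ltrans Ltotal.
pose f x := #|[set y in U | L y x]|.
have f_le x y : x \in U -> y \in U -> L x y -> f x <= f y.
  move=> xU yU Lxy; apply/subset_leq_card/subsetP => z; rewrite !inE.
  by case/andP=> zU Lzx; rewrite zU (Ltrans x).
have f_lt x y : x \in U -> y \in U -> ~~ L x y -> f y < f x.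
  move=> xU yU nLxy; have := Ltotal x y xU yU; rewrite (negPf nLxy) /= => Lyx.
  apply/proper_card/properP; split.
    apply/subsetP => z; rewrite !inE => /andP[zU Lzy].
    by rewrite zU (Ltrans y).
  by exists x; rewrite !inE xU /= ?Lrefl.
have fE : {in U &, forall x y, L x y = (f x <= f y)}.
  move=> x y xU yU; apply/idP/idP; first exact: f_le.
  by apply: contraTT => /(f_lt x y xU yU); rewrite -ltnNge.
exists f; split=> // x y xU yU fxy.
by apply: Lanti; rewrite // !fE ?fxy ?leqnn.
Qed.

Lemma extremes_ends f (L : rel V) A :
  {in A &, injective f} -> {in A &, forall x y, L x y = (f x <= f y)} ->
  minimals L A :|: maximals L A = ends f A.
Proof.
move=> f_inj LE; apply/setP => x; rewrite !inE -andb_orr.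
case: (boolP (x \in A)) => //= xA.
apply/idP/idP.
  move=> xM; apply/forall_inP => y yA; apply/forall_inP => z zA.
  case/orP: xM => /forall_inP xM; apply/negP => ybz;
    move: (xM y yA) (xM z zA); rewrite !LE //;
    (case: eqP ybz => [->|_]); rewrite /btw ?ltnn ?andbF //;
    (case: (z =P x) => [->|_]); rewrite ?ltnn ?andbF //; lia.
move=> /forall_inP xE; rewrite -[_ || _]negbK negb_or; apply/negP.
case/andP => /forall_inPn[y yA]; rewrite negb_imply LE // => /andP[le_yx ne_yx].
case/forall_inPn => [z zA]; rewrite negb_imply LE // => /andP[le_xz ne_zx].
have := forall_inP (xE y yA) z zA; apply/negP; rewrite negbK /btw.
rewrite [f y < f x]ltn_neqAle le_yx [f x < f z]ltn_neqAle le_xz !andbT.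
rewrite (inj_in_eq f_inj) // (inj_in_eq f_inj) // ne_yx eq_sym.
by rewrite ne_zx.
Qed.

(** The ends are the elements of least and of greatest rank. *)
Lemma card_ends f A : {in A &, injective f} -> 1 < #|A| -> #|ends f A| = 2.
Proof.
move=> f_inj A_gt1; have [x0 x0A] : exists x, x \in A by apply/card_gt0P; lia.
pose lo := [arg min_(i < x0 in A) f i]; pose hi := [arg max_(i > x0 in A) f i].
have [loA lo_min] : lo \in A /\ {in A, forall y, f lo <= f y}.
  by rewrite /lo; case: arg_minnP.
have [hiA hi_max] : hi \in A /\ {in A, forall y, f y <= f hi}.
  by rewrite /hi; case: arg_maxnP.
have ne_lohi : lo != hi.
  apply: contraTneq A_gt1 => eq_lh; rewrite -leqNgt -(cards1 lo).
  apply/subset_leq_card/subsetP => x xA; rewrite inE; apply/eqP/f_inj => //.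
  by have := lo_min x xA; have := hi_max x xA; rewrite -eq_lh; lia.
rewrite (_ : ends f A = [set lo; hi]) ?cards2 ?ne_lohi //.
apply/setP => x; rewrite !inE; apply/idP/idP.
  case/andP=> xA /forall_inP/(_ lo loA)/forall_inP/(_ hi hiA) nb.
  rewrite -(inj_in_eq f_inj) // -[x == hi](inj_in_eq f_inj) //.
  by have := lo_min x xA; have := hi_max x xA; move: nb; rewrite /btw; lia.
case/orP=> /eqP->; rewrite ?loA ?hiA; apply/forall_inP => y yA; apply/forall_inP => z zA;
  move: (lo_min _ yA) (lo_min _ zA) (hi_max _ yA) (hi_max _ zA);
  rewrite /btw; lia.
Qed.

Lemma exists_between_card A D k :
  A \subset D -> #|A| <= k <= #|D| ->
  exists B, [/\ A \subset B, B \subset D & #|B| = k].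
Proof.
move=> AD /andP[Ak kD]; have [n kE] : exists n, k = #|A| + n.
  by exists (k - #|A|); lia.
elim: n A AD Ak kE => [|n IHn] A AD Ak kE.
  by exists A; rewrite subxx AD kE addn0.
have [x xD xA] : exists2 x, x \in D & x \notin A.
  by apply/subsetPn; apply: contraTN kD => /subset_leq_card; lia.
have cardxA : #|x |: A| = #|A|.+1 by rewrite cardsU1 xA.
have [|||B [xAB BD Bk]] := IHn (x |: A); rewrite ?cardxA; [|lia|lia|].
  by rewrite subUset sub1set xD.
by exists B; split=> //; apply: subset_trans xAB; apply: subsetUr.
Qed.

(** * Ternary betweenness relations *)

(** Choose [p] that is not between any two points, and order the points by
    their distance from [p]: [x] precedes [y] when [x] is between [p] and [y].
    Then each property of this order concerns [p] and at most three other
    points, and can be read off a rank on these four. Such a [p] exists: take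
    [p] and [q] with the largest number of points between them. If [p] were
    between [x] and [y], then it would be between one of them and [q], and that
    pair would enclose more points. *)
Lemma betweenness_representable (T : V -> V -> V -> bool) :
  (forall a b c d, exists f, {in [set a; b; c; d] &, injective f} /\
     {in [set a; b; c; d] & &, forall x y z, T x y z = btw f x y z}) ->
  exists g, injective g /\ forall x y z, T x y z = btw g x y z.
Proof.
move=> T4.
(* Injectivity as an equality of booleans, and lists instead of sets, so that
   [lia] decides the statements about four points after rewriting. *)
have {}T4 a b c d : exists f,
    {in [:: a; b; c; d] &, forall x y, (x == y) = (f x == f y)} /\
    {in [:: a; b; c; d] & &, forall x y z, T x y z = btw f x y z}.
  have [f [f_inj fE]] := T4 a b c d.
  have sub x : x \in [:: a; b; c; d] -> x \in [set a; b; c; d].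
    by rewrite !inE -!orbA.
  exists f; split=> [x y /sub xS /sub yS | x y z /sub xS /sub yS /sub zS].
    by rewrite (inj_in_eq f_inj).
  exact: fE.
pose mem4 := (inE, eqxx, orbT).
have [p0 _ | V0] := pickP (@predT V); last first.
  by exists (fun=> 0); split=> [x | x]; have := V0 x.
pose I (pq : V * V) := [set z | T pq.1 z pq.2].
have [p p_end] : exists p, forall x y, ~~ T x p y.
  have [[p q] _ pq_max] := arg_maxnP (fun pq => #|I pq|) (isT : predT (p0, p0)).
  exists p => x y; apply/negP => Txpy.
  have Twpq w : ~~ T w p q.
    apply/negP => Tw; have := pq_max (w, q) isT; rewrite /= leqNgt.
    case/negP; apply/proper_card/properP; split; last first.
      exists p; rewrite inE //=; have [f [_ fE]] := T4 p q q q.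
      by rewrite fE ?mem4 // /btw; lia.
    apply/subsetP => z; rewrite !inE /=; have [f [_ fE]] := T4 w p q z.
    by move: Tw; rewrite !fE ?mem4 // /btw; lia.
  have [pq | ne_pq] := eqVneq p q.
    have := pq_max (x, y) isT; rewrite /= leqNgt; case/negP.
    rewrite (_ : I (p, q) = set0) ?cards0.
      by apply/card_gt0P; exists p; rewrite inE.
    apply/setP => z; rewrite !inE /= -pq; have [f [_ fE]] := T4 p z z z.
    by rewrite fE ?mem4 // /btw; lia.
  have [f [f_eq fE]] := T4 x p y q.
  move: (Twpq x) (Twpq y) Txpy ne_pq; rewrite f_eq ?mem4 // !fE ?mem4 // /btw.
  lia.
pose L x y := [|| x == p, x == y | T p x y].
have Lspec x y z : exists h : V -> nat,
    [/\ {in [:: x; y; z] &, forall u v, (u == v) = (h u == h v)},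
        {in [:: x; y; z] &, forall u v, L u v = (h u <= h v)} &
        {in [:: x; y; z] & &, forall u v w, T u v w = btw h u v w}].
  have [f [f_eq fE]] := T4 p x y z.
  have sub u : u \in [:: x; y; z] -> u \in [:: p; x; y; z].
    by move=> uS; rewrite inE uS orbT.
  have same_side u v : u \in [:: x; y; z] -> v \in [:: x; y; z] ->
      ~~ btw f u p v.
    by move=> /sub uS /sub vS; rewrite -fE ?p_end // inE eqxx.
  have pS : p \in [:: p; x; y; z] by rewrite inE eqxx.
  (* the absolute difference [|f u - f p|], in truncated subtraction *)
  exists (fun u => (f u - f p) + (f p - f u)).
  split=> [u v uS vS|u v uS vS|u v w uS vS wS];
    have uS4 := sub u uS; have vS4 := sub v vS.
  - by have := same_side u v uS vS; rewrite f_eq // /btw; lia.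
  - by have := same_side u v uS vS; rewrite /L !f_eq // fE // /btw; lia.
  - have := same_side u v uS vS; have := same_side u w uS wS.
    by have := same_side v w vS wS; rewrite fE ?sub // /btw; lia.
have Llin : linear_order_on [set: V] L.
  split=> [x _|x y _ _|x y z _ _ _|x y _ _].
  - by rewrite /L eqxx orbT.
  - have [h [h_eq hE _]] := Lspec x y y.
    by rewrite !hE ?mem4 // => le_h; apply/eqP; rewrite h_eq ?mem4 //; lia.
  - by have [h [_ hE _]] := Lspec x y z; rewrite !hE ?mem4 //; lia.
  - by have [h [_ hE _]] := Lspec x y y; rewrite !hE ?mem4 //; lia.
have [g [g_inj gE]] := linear_rank Llin.
have {}gE x y : L x y = (g x <= g y) by apply: gE; rewrite inE.
exists g; split=> [x y|x y z]; first by apply: g_inj; rewrite inE.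
have [h [_ hE hT]] := Lspec x y z.
rewrite hT ?mem4 // /btw !ltnNge -!gE !hE ?mem4 //.
Qed.

End Ranks.

(** * Agreeing rank functions *)

Section Agreeing.
Variables (r : nat) (H : marked_clique r).
Hypothesis r_ge3 : 3 <= r.
Let V := vertex H.
Implicit Types (f g : V -> nat) (x y z a b c s : V) (A B C U W e : {set V}).

(** [agreesP] relates this to the relational form of an agreeing order. *)
Definition agrees U f :=
  {in U &, injective f} /\
  forall e, e \in edges H -> e \subset U -> ends f e = marks e.

Lemma agreesP U : has_agreeing_order_on U <-> exists f, agrees U f.
Proof.
split=> [[L [Llin LE]] | [f [f_inj fE]]].
  have [f [f_inj fL]] := linear_rank Llin; exists f; split=> // e eE eU.
  rewrite -LE // (@extremes_ends _ f) // => x y /(subsetP eU) xU /(subsetP eU) yU.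
    exact: f_inj.
  exact: fL.
exists (fun x y => f x <= f y); split; first exact: rank_linear.
move=> e eE eU; rewrite -fE //; apply: extremes_ends => //.
by move=> x y /(subsetP eU) xU /(subsetP eU) yU; apply: f_inj.
Qed.

Lemma agrees_sub U W f : W \subset U -> agrees U f -> agrees W f.
Proof.
move=> WU [f_inj fE]; split.
  by move=> x y /(subsetP WU) xU /(subsetP WU) yU; apply: f_inj.
by move=> e eE eW; apply: fE => //; apply: subset_trans WU.
Qed.

(** If [x] lies between [y] and [z] in [A], then any edge of [A] through these
    three vertices does not mark [x]; there is one since [3 <= r <= #|A|]. *)
Lemma mem_ends_marks U f A x :
  agrees U f -> A \subset U -> r <= #|A| -> x \in A ->
  x \in ends f A <->
  (forall e, e \in edges H -> e \subset A -> x \in e -> x \in marks e).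
Proof.
move=> [f_inj fE] AU rA xA; split=> [/endsP[_ xE] e eE eA xe | xM].
  rewrite -fE ?(subset_trans eA) //; apply/endsP; split=> // y z ye ze.
  by apply: xE; apply: (subsetP eA).
apply/endsP; split=> // y z yA zA; apply/negP => yxz.
have [|| e [yxze eA er]] := @exists_between_card _ [set y; x; z] A r.
- by rewrite !subUset !sub1set yA xA zA.
- by rewrite rA andbT -setUA cardsU1 cards2; lia.
have eE : e \in edges H by rewrite inE er.
move: yxze; rewrite !subUset !sub1set => /andP[/andP[ye xe] ze].
have := xM e eE eA xe; rewrite -fE ?(subset_trans eA) // => /endsP[_].
by move/(_ y z ye ze); rewrite yxz.
Qed.

Lemma agrees_ends U f g A :
  agrees U f -> agrees U g -> A \subset U -> r <= #|A| -> ends f A = ends g A.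
Proof.
move=> fU gU AU rA; apply/setP => x; have [xA|xA] := boolP (x \in A).
  by apply/idP/idP => /mem_ends_marks-/(_ U) xM; apply/mem_ends_marks; eauto.
by rewrite !inE (negPf xA).
Qed.

(** The configuration to which [btw_agrees_sub] reduces long segments: [B] and
    [C] are nested segments with the common end [s] and the other ends [b] and
    [c]. In the direction where [s] comes first in [C], [c] comes last, so [b]
    comes after [s] and is last in [B], whence [a < b < c]. *)
Lemma btw_nested g B C a b c s :
  {in C &, injective g} -> B \subset C ->
  [/\ a \in B, b \in B & c \in C] -> [/\ a != b, b != c & a != c] ->
  s != b -> s != c ->
  s \in ends g B -> s \in ends g C -> b \in ends g B -> c \in ends g C ->
  btw g a b c.
Proof.
move=> g_inj BC [aB bB cC] [ab bc ac] sb sc.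
move=> /endsP[sB sEB] /endsP[sC sEC] /endsP[_ bE] /endsP[_ cE].
have [aC bC] := (subsetP BC _ aB, subsetP BC _ bB).
move: ab bc ac sb sc.
rewrite -!(inj_in_eq g_inj) //.
move: (cE a b aC bC) (cE s b sC bC) (cE s a sC aC) (bE s a sB aB).
move: (sEC a b aC bC) (sEC b c bC cC) (sEC a c aC cC).
rewrite /btw; lia.
Qed.

(** Let [a < b < c] for [f]. If the initial segment [dn b] has at least [r]
    elements, so does [dn c], and both have the least element of [U] as their
    other end: this is [btw_nested]. The case of a large [up b] is symmetric.
    Otherwise both segments at [b] have exactly [r - 1] elements, so that
    [up a] and [dn c] have at least [r]. Then [a] is an end of [up a], which
    contains [b] and [c], and [c] is an end of [dn c], which contains [a] and
    [b]; in any order this puts [b] in the middle. *)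
Lemma btw_agrees_sub U f g a b c :
  #|U| = 2 * r - 3 -> agrees U f -> agrees U g ->
  a \in U -> b \in U -> c \in U -> btw f a b c -> btw g a b c.
Proof.
move=> Ucard fU gU; have [f_inj _] := fU; have [g_inj _] := gU.
wlog ltf : a c / f a < f b < f c => [IH aU bU cU /orP[?|?]|aU bU cU _].
- by apply: IH => //; rewrite /btw; lia.
- suff: btw g c b a by rewrite /btw; lia.
  by apply: IH => //; rewrite /btw; lia.
pose dn x := [set y in U | f y <= f x]; pose up x := [set y in U | f x <= f y].
have dnU x : dn x \subset U by apply/subsetP => y; rewrite inE => /andP[].
have upU x : up x \subset U by apply/subsetP => y; rewrite inE => /andP[].
have E A : A \subset U -> r <= #|A| -> ends f A = ends g A by apply: agrees_ends.
have dn_end x : x \in U -> x \in ends f (dn x).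
  by move=> xU; apply/endsP; split=> [|y z]; rewrite !inE ?xU /btw /=; lia.
have up_end x : x \in U -> x \in ends f (up x).
  by move=> xU; apply/endsP; split=> [|y z]; rewrite !inE ?xU /btw /=; lia.
have neq : [/\ a != b, b != c & a != c].
  by split; apply: contraTneq ltf => ->; lia.
have updn x : x \in U -> #|up x| + #|dn x| = #|U|.+1.
  move=> xU; rewrite -cardsUI (_ : up x :|: dn x = U).
    rewrite (_ : up x :&: dn x = [set x]) ?cards1 ?addn1 //.
    apply/setP => y; rewrite !inE; have [->|/=] := eqVneq y x; first by rewrite xU leqnn.
    have [yU|] //= := boolP (y \in U).
    by rewrite -(inj_in_eq f_inj) //; lia.
  by apply/setP => y; rewrite !inE -andb_orr leq_total andbT.
have [dnb_ge|dnb_lt] := leqP r #|dn b|.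
  have dnbc : dn b \subset dn c.
    by apply/subsetP => y; rewrite !inE => /andP[->] /=; lia.
  have dnc_ge : r <= #|dn c| by apply: leq_trans dnb_ge (subset_leq_card dnbc).
  have [s [sU s_min]] : exists s, s \in U /\ {in U, forall y, f s <= f y}.
    by have [s sU s_min] := arg_minnP f aU; exists s.
  have s_end x : x \in U -> s \in ends f (dn x).
    move=> xU; apply/endsP; split=> [|y z]; rewrite !inE.
      by rewrite sU s_min.
    by move=> /andP[/s_min sy _] /andP[/s_min sz _]; rewrite /btw; lia.
  have sa := s_min a aU.
  apply: (@btw_nested g (dn b) (dn c) a b c s) => //; rewrite -?E ?dn_end ?s_end //.
  - by move=> x y; rewrite !inE => /andP[xU _] /andP[yU _]; apply: g_inj.
  - by split; rewrite inE ?aU ?bU ?cU /=; lia.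
  - by apply: contraTneq ltf => <-; lia.
  - by apply: contraTneq ltf => <-; lia.
have [upb_ge|upb_lt] := leqP r #|up b|.
  have upba : up b \subset up a.
    by apply/subsetP => y; rewrite !inE => /andP[->] /=; lia.
  have upa_ge : r <= #|up a| by apply: leq_trans upb_ge (subset_leq_card upba).
  have [s [sU s_max]] : exists s, s \in U /\ {in U, forall y, f y <= f s}.
    by have [s sU s_max] := arg_maxnP f aU; exists s.
  have s_end x : x \in U -> s \in ends f (up x).
    move=> xU; apply/endsP; split=> [|y z]; rewrite !inE.
      by rewrite sU s_max.
    by move=> /andP[/s_max sy _] /andP[/s_max sz _]; rewrite /btw; lia.
  have sc := s_max c cU.
  suff: btw g c b a by rewrite /btw; lia.
  apply: (@btw_nested g (up b) (up a) c b a s) => //; rewrite -?E ?up_end ?s_end //.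
  - by move=> x y; rewrite !inE => /andP[xU _] /andP[yU _]; apply: g_inj.
  - by split; rewrite inE ?aU ?bU ?cU /=; lia.
  - by case: neq => ab bc ac; split; rewrite eq_sym.
  - by apply: contraTneq ltf => <-; lia.
  - by apply: contraTneq ltf => <-; lia.
have upa_ge : r <= #|up a|.
  suff /proper_card : up b \proper up a by have := updn b bU; lia.
  apply/properP; split; last by exists a; rewrite inE ?aU ?leqnn //=; lia.
  by apply/subsetP => y; rewrite !inE => /andP[->] /=; lia.
have dnc_ge : r <= #|dn c|.
  suff /proper_card : dn b \proper dn c by have := updn b bU; lia.
  apply/properP; split; last by exists c; rewrite inE ?cU ?leqnn //=; lia.
  by apply/subsetP => y; rewrite !inE => /andP[->] /=; lia.
have := up_end a aU; rewrite E // => /endsP[_ /(_ b c)].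
have := dn_end c cU; rewrite E // => /endsP[_ /(_ a b)].
rewrite !inE aU bU cU /=; case: neq => ab bc ac; move: ab bc ac.
rewrite -!(inj_in_eq g_inj) // /btw => ab bc ac H1 H2.
have {}H1 := H1 ltac:(lia) ltac:(lia); have {}H2 := H2 ltac:(lia) ltac:(lia).
lia.
Qed.

Lemma btw_agrees U f g a b c :
  #|U| = 2 * r - 3 -> agrees U f -> agrees U g ->
  a \in U -> b \in U -> c \in U -> btw f a b c = btw g a b c.
Proof.
by move=> ? ? ? ? ? ?; apply/idP/idP; apply: btw_agrees_sub; eauto.
Qed.

(** By induction on [#|W :\: U|]: if [U] is not [W], exchange a vertex [y] of
    [U] outside [W] for a vertex [x] of [W] outside [U]. The two sets share
    [U :\ y], whose [2 * r - 3] vertices include [a], [b] and [c], so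
    [btw_agrees] applies. *)
Lemma btw_common (F : {set V} -> V -> nat) U W a b c :
  (forall X : {set V}, #|X| = 2 * r - 2 -> agrees X (F X)) ->
  #|U| = 2 * r - 2 -> #|W| = 2 * r - 2 ->
  [/\ a \in U, b \in U & c \in U] -> [/\ a \in W, b \in W & c \in W] ->
  btw (F U) a b c = btw (F W) a b c.
Proof.
move=> FE Ucard Wcard abcU [aW bW cW].
have [n] := ubnP #|W :\: U|; elim: n U Ucard abcU => // n IHn U Ucard [aU bU cU] WUn.
have [WU|/subsetPn[x xW xU]] := boolP (W \subset U).
  by have /eqP-> : W == U by rewrite eqEcard WU Ucard Wcard leqnn.
have /subsetPn[y yU yW] : ~~ (U \subset W).
  apply: contra xU => UW; suff /eqP-> : U == W by [].
  by rewrite eqEcard UW Ucard Wcard leqnn.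
have ne z : z \in W -> z != y by apply: contraTneq => ->.
pose U' := x |: (U :\ y).
have Uy : #|U :\ y| = 2 * r - 3 by have := cardsD1 y U; rewrite yU; lia.
have U'card : #|U'| = 2 * r - 2.
  by rewrite cardsU1 !inE (negPf xU) andbF; lia.
transitivity (btw (F U') a b c).
  apply: (@btw_agrees (U :\ y)); rewrite ?inE ?ne //.
    by apply: agrees_sub (FE U Ucard); apply: subsetDl.
  by apply: agrees_sub (FE U' U'card); apply: subsetUr.
apply: IHn => //; first by split; rewrite !inE ne ?aU ?bU ?cU ?orbT.
move: WUn; rewrite ltnS; apply: leq_trans; apply: proper_card.
apply/properP; split.
  apply/subsetP => z; rewrite !inE negb_or negb_and negbK => /andP[/andP[_ zz] zW].
  by move: zz; rewrite (negPf (ne z zW)) zW andbT.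
by exists x; rewrite !inE ?xU ?xW ?eqxx.
Qed.

Lemma agreeing_order_from_local :
  2 * r - 2 <= #|V| ->
  (forall U, #|U| = 2 * r - 2 -> has_agreeing_order_on U) ->
  has_agreeing_order H.
Proof.
move=> Vcard local; apply/agreesP.
have /fin_all_exists[F FE] (U : {set V}) :
    exists f : V -> nat, #|U| = 2 * r - 2 -> agrees U f.
  case: (#|U| =P 2 * r - 2) => [/local/agreesP[f fU]|]; first by exists f.
  by exists (fun=> 0).
have extend A : #|A| <= 2 * r - 2 -> exists2 U : {set V}, A \subset U & #|U| = 2 * r - 2.
  move=> Acard; have [||U [AU _ Ucard]] := @exists_between_card _ A setT (2 * r - 2).
  - exact: subsetT.
  - by rewrite Acard cardsT.
  by exists U.
pose T x y z := [exists U : {set V}, [&& #|U| == 2 * r - 2,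
  x \in U, y \in U, z \in U & btw (F U) x y z]].
have TE U x y z : #|U| = 2 * r - 2 -> x \in U -> y \in U -> z \in U ->
    T x y z = btw (F U) x y z.
  move=> Ucard xU yU zU; apply/existsP/idP => [[W]|xyz]; last first.
    by exists U; rewrite Ucard eqxx xU yU zU.
  by case/and5P=> /eqP Wcard xW yW zW; rewrite (@btw_common F W U).
have [a b c d|g [g_inj gT]] := @betweenness_representable _ T.
  have [|U abcdU Ucard] := extend [set a; b; c; d].
    by rewrite -!setUA !cardsU1 cards1; lia.
  exists (F U); have [F_inj _] := FE U Ucard; split.
    by move=> x y /(subsetP abcdU) xU /(subsetP abcdU) yU; apply: F_inj.
  by move=> x y z /(subsetP abcdU) ? /(subsetP abcdU) ? /(subsetP abcdU) ?; apply: TE.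
exists g; split=> [x y _ _|e eE _]; first exact: g_inj.
have [|U eU Ucard] := extend e; first by move: eE; rewrite inE => /eqP->; lia.
have [_ <- //] := FE U Ucard; apply: eq_ends => x y z.
by move=> /(subsetP eU) ? /(subsetP eU) ? /(subsetP eU) ?; rewrite -gT; apply: TE.
Qed.

End Agreeing.

(** * A marked clique on 2r - 2 vertices without agreeing order *)

Section Counterexample.
Variable r : nat.
Hypothesis r_ge3 : 3 <= r.
Let n := 2 * r - 2.
Let V : finType := 'I_n.
(** The two middle vertices of the natural order. *)
Let p := r - 2.
Let q := r - 1.

Let nat_rank (x : V) : nat := x.

Let swap_rank (x : V) : nat :=
  if x == p :> nat then q else if x == q :> nat then p else x.

Let top : {set V} := [set x : V | p <= x].
Let bot : {set V} := [set x : V | x < r].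

Let card_top : #|top| = r.
Proof.
rewrite cardsE -sum1_card -(big_geq_mkord p n xpredT (fun=> 1)) /=.
by rewrite sum_nat_const_nat /n /p; lia.
Qed.

Let card_bot : #|bot| = r.
Proof.
rewrite cardsE -sum1_card -(big_ord_widen n (fun=> 1)).
  by rewrite sum_nat_const card_ord muln1.
by rewrite /n; lia.
Qed.

Let nat_rank_inj : injective nat_rank. Proof. exact: val_inj. Qed.

Let swap_rankP (x : V) :
  x = p :> nat /\ swap_rank x = q \/ x = q :> nat /\ swap_rank x = p \/
  (x <> p :> nat /\ x <> q :> nat) /\ swap_rank x = x.
Proof.
rewrite /swap_rank; case: (nat_of_ord x =P p) => xp; first by left.
by right; case: (nat_of_ord x =P q) => xq; [left | right].
Qed.

Let swap_rank_inj : injective swap_rank.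
Proof.
move=> x y xy; apply: val_inj => /=; move: xy.
by have := swap_rankP x; have := swap_rankP y; rewrite /p /q; lia.
Qed.

Let swap_marks (e : {set V}) := ends (if e == top then swap_rank else nat_rank) e.

Let swap_marks_sub e : e \in clique_edges r V -> swap_marks e \subset e.
Proof. by move=> _; apply/subsetP => x /endsP[]. Qed.

Let swap_marks_card e : e \in clique_edges r V -> #|swap_marks e| = 2.
Proof.
rewrite inE => /eqP er; apply: card_ends; last by rewrite er; lia.
by case: ifP => _ x y _ _; [apply: swap_rank_inj | apply: nat_rank_inj].
Qed.

Let swapped : marked_clique r := MarkedClique swap_marks_sub swap_marks_card.

(** An edge other than [top] and [bot] has a vertex [y] before and a vertex [z]
    after both [p] and [q], so neither [p] nor [q] is an end of it in either
    order. *)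
Let swap_ends (e : {set V}) :
  #|e| = r -> e != top -> e != bot -> ends swap_rank e = ends nat_rank e.
Proof.
move=> er e_top e_bot.
have /subsetPn[y ye] : ~~ (e \subset top).
  by apply: contra e_top => et; rewrite eqEcard et er card_top leqnn.
have /subsetPn[z ze] : ~~ (e \subset bot).
  by apply: contra e_bot => et; rewrite eqEcard et er card_bot leqnn.
rewrite !inE => zr yp.
have sy : swap_rank y = y by have := swap_rankP y; rewrite /p /q in yp *; lia.
have sz : swap_rank z = z by have := swap_rankP z; rewrite /p /q in zr *; lia.
(* The swap moves only [p] and [q], which are consecutive, so it preserves the
   comparisons of any other vertex. *)
have mono (x w : V) : x < p \/ r <= x ->
    (swap_rank x < swap_rank w) = (x < w) /\ (swap_rank w < swap_rank x) = (w < x).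
  by have := swap_rankP x; have := swap_rankP w; rewrite /p /q; lia.
have mid (x : V) : ~ (x < p \/ r <= x) -> y < x < z /\ y < swap_rank x < z.
  by have := swap_rankP x; rewrite /p /q in zr yp *; lia.
apply/setP => x; case: (boolP ((x < p) || (r <= x))) => [/orP xo | xm].
  apply/endsP/endsP => -[xe xE]; split=> // u v ue ve;
    have := xE u v ue ve; have [mu mu'] := mono x u xo; have [mv mv'] := mono x v xo.
    by rewrite /btw mu mu' mv mv' /nat_rank.
  by rewrite /btw mu mu' mv mv' /nat_rank.
have [|xyz sxyz] := mid x; first by lia.
apply/endsP/endsP => -[xe xE]; have := xE y z ye ze.
  by rewrite /btw sy sz; lia.
by rewrite /btw /nat_rank; lia.
Qed.

Lemma local_orders_not_global :
  exists H : marked_clique r,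
     [/\ 2 * r - 2 <= #|vertex H|,
         (forall U : {set vertex H}, #|U| = 2 * r - 3 -> has_agreeing_order_on U)
       & ~ has_agreeing_order H].
Proof.
exists swapped; split=> [|U Ucard|/agreesP[f fH]].
- by rewrite /= card_ord.
(* A set that contains [top] and misses a vertex does not contain [bot]. *)
- apply/agreesP; have [tU|ntU] := boolP (top \subset U).
    exists swap_rank; split=> [x y _ _|e]; first exact: swap_rank_inj.
    rewrite inE => /eqP er eU; rewrite /= /swap_marks; case: eqP => // /eqP e_top.
    apply: swap_ends => //; apply: contraTneq eU => ->; apply/negP => bU.
    suff UT : U = setT by move: Ucard; rewrite UT cardsT card_ord /n; lia.
    apply/setP => x; rewrite inE; case: (leqP p x) => xp.
      by apply: (subsetP tU); rewrite inE.
    by apply: (subsetP bU); rewrite inE; rewrite /p in xp; lia.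
  exists nat_rank; split=> [x y _ _|e _ eU]; first exact: nat_rank_inj.
  by rewrite /= /swap_marks; case: eqP => // e_top; rewrite e_top (negPf ntU) in eU.
have [f_inj fE] := fH.
have ord k : k < n -> {x : V | x = k :> nat} by move=> lt_kn; exists (Ordinal lt_kn).
have [o oE] := ord 0 ltac:(rewrite /n; lia).
have [l lE] := ord (2 * r - 3) ltac:(rewrite /n; lia).
have [u uE] := ord p ltac:(rewrite /n /p; lia).
have [v vE] := ord q ltac:(rewrite /n /q; lia).
(* The first and last vertices are fixed by the swap, and are extreme in both
   orders; so they are marked in every edge through them. *)
have outer x : x = o \/ x = l -> x \in ends f setT.
  move=> xol; apply/(mem_ends_marks r_ge3 fH); rewrite ?inE ?cardsT ?card_ord //.
    by rewrite /n; lia.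
  move=> e eE _ xe; rewrite /= /swap_marks; apply/endsP; split=> // y z _ _.
  have ltzn : z < 2 * r - 2 := ltn_ord z; have ltyn : y < 2 * r - 2 := ltn_ord y.
  have {}xol : x = 0 :> nat \/ x = 2 * r - 3 :> nat
    by case: xol => ->; rewrite ?oE ?lE; auto.
  case: ifP => _; have := swap_rankP x; have := swap_rankP y; have := swap_rankP z;
    rewrite /btw /nat_rank /p /q; lia.
have /endsP[_ o_end] := outer o (or_introl erefl).
have /endsP[_ l_end] := outer l (or_intror erefl).
have /endsP[_ v_top] : v \in ends f top.
  have topE : top \in edges swapped by rewrite inE card_top.
  rewrite fE ?subsetT //= /swap_marks eqxx; apply/endsP.
  rewrite inE vE /p /q; split=> [|y z]; first by lia.
  have := swap_rankP v; have := swap_rankP y; have := swap_rankP z.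
  by rewrite !inE /btw vE /p /q; lia.
have /endsP[_ v_bot] : v \in ends f bot.
  have botE : bot \in edges swapped by rewrite inE card_bot.
  rewrite fE ?subsetT //= /swap_marks.
  have /negPf-> : bot != top.
    by apply/eqP => /setP/(_ o); rewrite !inE oE /p; lia.
  apply/endsP; rewrite inE vE /q; split=> [|y z]; first by lia.
  by rewrite !inE /btw /nat_rank vE /q; lia.
(* Since [u] and [v] lie between [o] and [l], the edge [bot] gives that [v] is
   beyond [u] as seen from [o], while [top] gives the converse. *)
have := v_top u l; have := v_bot o u; rewrite !inE uE lE oE /p.
move=> /(_ ltac:(lia) ltac:(lia)) b1 /(_ ltac:(lia) ltac:(lia)) b2.
have neq (x y : V) : x <> y :> nat -> f x != f y.
  by move=> ne; apply/eqP => fxy; apply: ne; rewrite (f_inj x y) ?inE.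
have inner (x : V) : x <> o :> nat -> x <> l :> nat -> btw f o x l.
  move=> /neq xo /neq xl; have ol : f o != f l by apply: neq; rewrite oE lE; lia.
  have := o_end x l (in_setT _) (in_setT _).
  have := l_end o x (in_setT _) (in_setT _).
  by rewrite /btw; lia.
have uv : f u != f v by apply: neq; rewrite uE vE /p /q; lia.
have := inner u; have := inner v; rewrite uE vE oE lE /p /q.
move=> /(_ ltac:(lia) ltac:(lia)) ov /(_ ltac:(lia) ltac:(lia)) ou.
move: b1 b2 ou ov uv; rewrite /btw.
clear; move: (f o) (f u) (f v) (f l) => fo fu fv fl; lia.
Qed.

End Counterexample.

Theorem theorem1 (r : nat) (hr : 3 <= r) :
  (forall H : marked_clique r,
     2 * r - 2 <= #|vertex H| ->
     (forall U : {set vertex H}, #|U| = 2 * r - 2 -> has_agreeing_order_on U) ->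
     has_agreeing_order H)
  /\
  (exists H : marked_clique r,
     [/\ 2 * r - 2 <= #|vertex H|,
         (forall U : {set vertex H}, #|U| = 2 * r - 3 -> has_agreeing_order_on U)
       & ~ has_agreeing_order H]).
Proof.
split; last exact: local_orders_not_global.
by move=> H; apply: agreeing_order_from_local.
Qed.
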